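(* Let $R$ be a commutative ring with $1$ and let $E$ be a row-finite directed graph with $C_u(E)=\varnothing$ (equivalently, $E$ satisfies Condition (K)). Let $I\trianglelefteq L_R(E)$ be an ideal corresponding to the saturated function $f\in\mathscr{F}_{E,R}$. If $I$ is prime, then for any ideal $J\trianglelefteq R$, the set $H:=\max\{H'\in\mathscr{T}_E\mid J\subseteq f(H')\}$ (the largest such $H'$, which exists because $f$ is saturated) has the property that $E^0\setminus H$ is downward directed.
   Context: A directed graph $E=(E^0,E^1,r,s)$ has vertices $E^0$, edges $E^1$, range and source maps $r,s:E^1\to E^0$; it is row-finite if $s^{-1}(v)$ is finite for every $v$. A vertex $v$ is regular if $s^{-1}(v)$ is finite and nonempty. A path of positive length is $e_1\cdots e_n$ with $r(e_i)=s(e_{i+1})$; vertices are paths of length $0$. A path with $n>0$ is closed if $s(e_1)=r(e_n)$; a closed path is simple if $s(e_i)=s(e_1)$ implies $i=1$, and a cycle if $s(e_i)=s(e_j)$ implies $i=j$. $C_u(E)$ is the set of (rotation classes of) cycles $c$ such that there is exactly one closed simple path based at $s(c)=r(c)$. $L_R(E)$, the Leavitt path algebra, is the universal associative $R$-algebra generated by $E^0\cup E^1\cup\{e^*\mid e\in E^1\}$ subject to: $vw=\delta_{vw}v$; $s(e)e=e=er(e)$; $r(e)e^*=e^*=e^*s(e)$; $e^*f=\delta_{ef}r(e)$; $u=\sum_{e\in s^{-1}(u)}ee^*$ for regular $u$. Ideals are two-sided. An ideal $P$ of a ring $A$ is prime if $P\neq A$ and for ideals $I_1,I_2$ of $A$,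 $I_1I_2\subseteq P$ implies $I_1\subseteq P$ or $I_2\subseteq P$. $H\subseteq E^0$ is hereditary if for every path $\mu$, $s(\mu)\in H$ implies $r(\mu)\in H$; saturated if for every regular $v$, $r(s^{-1}(v))\subseteq H$ implies $v\in H$. Since $E$ is row-finite, $\mathscr{T}_E$ is the complete lattice of hereditary saturated subsets of $E^0$ under inclusion, $\mathscr{T}_E^*=\mathscr{T}_E\setminus\{\varnothing\}$, and $\mathscr{F}_{E,R}$ (the saturated functions) is the set of functions $f$ from $\mathscr{T}_E^*$ to the ideals of $R$ with $f(\bigvee_iH_i)=\bigcap_if(H_i)$ for all nonempty families in $\mathscr{T}_E^*$. By convention $f(\varnothing)=R$. The saturated function corresponding to an ideal $I$ of $L_R(E)$ is $f(H)=\{r\in R\mid rv\in I\text{ for all }v\in H\}$. A subset $S\subseteq E^0$ is downward directed if for all $v,w\in S$ there exists $u\in S$ such that there are paths in $E$ from $v$ to $u$ and from $w$ to $u$. *)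

(* Defs.v *)
From HB Require Import structures.
From mathcomp Require Import all_boot all_order all_algebra.
From mathcomp Require Import generic_quotient.
From mathcomp Require Import mathcomp_extra boolp classical_sets functions.
From mathcomp Require Import cardinality fsbigop.

Set Implicit Arguments.
Unset Strict Implicit.
Unset Printing Implicit Defensive.

Import GRing.Theory.
Local Open Scope ring_scope.
Local Open Scope quotient_scope.
Local Open Scope classical_set_scope.

Record digraph := Digraph {
  vertex : choiceType;
  edge : choiceType;
  src : edge -> vertex;
  rng : edge -> vertex }.

Section Graph.
Variable E : digraph.
Implicit Types (v w : vertex E) (e : edge E) (p c : seq (edge E)).

Definition out v : set (edge E) := [set e | src e = v].

Definition row_finite := forall v, finite_set (out v).

Definition regular v := finite_set (out v) /\ out v !=set0.

(* is_path v p w : p is a path from v to w.  The endpoints are carried along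
   because the list of edges of a path of length 0 does not determine them. *)
Fixpoint is_path v p w : Prop :=
  if p is e :: p' then src e = v /\ is_path (rng e) p' w else v = w.

(* The next three predicates say that c is a closed path (resp. a closed simple
   path, a cycle) based at v; in particular v is the source of the first edge. *)
Definition closed_path v c := c <> [::] /\ is_path v c v.

Definition closed_simple_path v c :=
  closed_path v c /\ v \notin [seq src e | e <- behead c].

Definition cycle_at v c := closed_path v c /\ uniq [seq src e | e <- c].

Definition rotation_class c : set (seq (edge E)) := [set rot n c | n in setT].

Definition C_u : set (set (seq (edge E))) :=
  [set C | exists v c, [/\ cycle_at v c, (exists! c', closed_simple_path v c')
                         & C = rotation_class c]].

Definition downward_directed (S : set (vertex E)) :=
  forall v w, S v -> S w ->
    exists u, [/\ S u, exists p, is_path v p u & exists p, is_path w p u].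

Definition hereditary (H : set (vertex E)) :=
  forall v p w, is_path v p w -> H v -> H w.

Definition saturated (H : set (vertex E)) :=
  forall v, regular v -> (@rng E) @` (out v) `<=` H -> H v.

Record hsat := HSat {
  hsat_set :> set (vertex E);
  hsatP : hereditary hsat_set /\ saturated hsat_set }.

Lemma hsat_join_subproof (F : set hsat) :
  let U := \bigcap_(K in [set K : hsat | forall H, F H -> H `<=` K]) (K : set _)
  in hereditary U /\ saturated U.
Proof.
split=> [v p w vpw Uv K FK|v rv sv K FK].
  exact: (proj1 (hsatP K)) vpw (Uv K FK).
by apply: (proj2 (hsatP K)) => // w /sv /(_ K FK).
Qed.

Definition hsat_join (F : set hsat) : hsat := HSat (hsat_join_subproof F).

Lemma hsat_join_ub (F : set hsat) (H : hsat) : F H -> H `<=` hsat_join F.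
Proof. by move=> FH v Hv K /(_ H FH); exact. Qed.

Lemma hsat_join_le (F : set hsat) (K : hsat) :
  (forall H, F H -> H `<=` K) -> hsat_join F `<=` K.
Proof. by move=> FK v /(_ K FK). Qed.

Definition nehsat := {H : hsat | (H : set _) !=set0}.

Lemma nehsat_join_subproof (F : set nehsat) :
  F !=set0 -> (hsat_join [set sval K | K in F] : set _) !=set0.
Proof.
case=> K FK; have [v Kv] := svalP K.
by exists v; apply: (hsat_join_ub (H := sval K)) => //; exists K.
Qed.

Definition nehsat_join (F : set nehsat) (F0 : F !=set0) : nehsat :=
  exist _ (hsat_join [set sval K | K in F]) (nehsat_join_subproof F0).

End Graph.

Arguments C_u : clear implicits.

(* Two-sided ideals for an additive group with a product m which is not assumed
   to have a unit; this is used both for R and for L_R(E). *)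

Section Ideal.
Variables (A : zmodType) (m : A -> A -> A).

Record ideal := Ideal {
  ideal_set :> set A;
  ideal0 : ideal_set 0;
  idealB : forall x y, ideal_set x -> ideal_set y -> ideal_set (x - y);
  idealMl : forall a x, ideal_set x -> ideal_set (m a x);
  idealMr : forall a x, ideal_set x -> ideal_set (m x a) }.

Definition ideal_prod (I J : ideal) : set A :=
  [set z | exists s : seq (A * A),
     (forall x, x \in s -> ideal_set I x.1 /\ ideal_set J x.2) /\ z = \sum_(x <- s) m x.1 x.2].

Definition prime_ideal (P : ideal) :=
  (P : set A) <> setT /\
  forall I J : ideal, ideal_prod I J `<=` P -> I `<=` P \/ J `<=` P.

End Ideal.

Record nu_algebra (R : comPzRingType) := NUAlgebra {
  nua_sort :> lmodType R;
  nua_mul : nua_sort -> nua_sort -> nua_sort;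
  nua_mulA : associative nua_mul;
  nua_mulDl : left_distributive nua_mul +%R;
  nua_mulDr : right_distributive nua_mul +%R;
  nua_scaleAl : forall r x y, nua_mul (r *: x) y = r *: nua_mul x y;
  nua_scaleAr : forall r x y, nua_mul x (r *: y) = r *: nua_mul x y }.

Declare Scope nua_scope.
Delimit Scope nua_scope with nua.
Infix "**" := nua_mul (at level 40, left associativity) : nua_scope.
Local Open Scope nua_scope.

Record nua_hom (R : comPzRingType) (A B : nu_algebra R) (h : A -> B) : Prop := {
  nua_homD : forall x y, h (x + y) = h x + h y;
  nua_homZ : forall r x, h (r *: x) = r *: h x;
  nua_homM : forall x y, h (x ** y) = h x ** h y }.

Record leavitt_family (R : comPzRingType) (E : digraph) (A : nu_algebra R)
    (V : vertex E -> A) (T T' : edge E -> A) : Prop := {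
  lf_vv : forall v w, V v ** V w = if v == w then V v else 0;
  lf_se : forall e, V (src e) ** T e = T e;
  lf_er : forall e, T e ** V (rng e) = T e;
  lf_rg : forall e, V (rng e) ** T' e = T' e;
  lf_gs : forall e, T' e ** V (src e) = T' e;
  lf_CK1 : forall e f, T' e ** T f = if e == f then V (rng e) else 0;
  lf_CK2 : forall v, regular v -> V v = \sum_(e \in out v) T e ** T' e }.

(* L_R(E) is the quotient of the non-unital R-algebra expressions in the
   generators by the least congruence containing the axioms of R-algebras and
   the defining relations. *)

Section LeavittPathAlgebra.
Variables (R : comPzRingType) (E : digraph).

Inductive lpa_term : Type :=
| TVertex of vertex E
| TEdge of edge E
| TGhost of edge E
| TZero
| TOpp of lpa_term
| TAdd of lpa_term & lpa_term
| TScale of R & lpa_term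
| TMul of lpa_term & lpa_term.

Implicit Types (x y z t : lpa_term) (r s : R).

Inductive lpa_rel : lpa_term -> lpa_term -> Prop :=
| rel_refl x : lpa_rel x x
| rel_sym x y : lpa_rel x y -> lpa_rel y x
| rel_trans x y z : lpa_rel x y -> lpa_rel y z -> lpa_rel x z
| rel_opp x y : lpa_rel x y -> lpa_rel (TOpp x) (TOpp y)
| rel_add x y z t : lpa_rel x y -> lpa_rel z t -> lpa_rel (TAdd x z) (TAdd y t)
| rel_scale r x y : lpa_rel x y -> lpa_rel (TScale r x) (TScale r y)
| rel_mul x y z t : lpa_rel x y -> lpa_rel z t -> lpa_rel (TMul x z) (TMul y t)
| rel_addA x y z : lpa_rel (TAdd x (TAdd y z)) (TAdd (TAdd x y) z)
| rel_addC x y : lpa_rel (TAdd x y) (TAdd y x)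
| rel_add0 x : lpa_rel (TAdd TZero x) x
| rel_addN x : lpa_rel (TAdd (TOpp x) x) TZero
| rel_scaleA r s x : lpa_rel (TScale r (TScale s x)) (TScale (r * s) x)
| rel_scale1 x : lpa_rel (TScale 1 x) x
| rel_scaleDr r x y :
    lpa_rel (TScale r (TAdd x y)) (TAdd (TScale r x) (TScale r y))
| rel_scaleDl r s x : lpa_rel (TScale (r + s) x) (TAdd (TScale r x) (TScale s x))
| rel_mulA x y z : lpa_rel (TMul x (TMul y z)) (TMul (TMul x y) z)
| rel_mulDl x y z : lpa_rel (TMul (TAdd x y) z) (TAdd (TMul x z) (TMul y z))
| rel_mulDr x y z : lpa_rel (TMul x (TAdd y z)) (TAdd (TMul x y) (TMul x z))
| rel_scaleAl r x y : lpa_rel (TMul (TScale r x) y) (TScale r (TMul x y))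
| rel_scaleAr r x y : lpa_rel (TMul x (TScale r y)) (TScale r (TMul x y))
| rel_vv v : lpa_rel (TMul (TVertex v) (TVertex v)) (TVertex v)
| rel_vw v w : v <> w -> lpa_rel (TMul (TVertex v) (TVertex w)) TZero
| rel_se e : lpa_rel (TMul (TVertex (src e)) (TEdge e)) (TEdge e)
| rel_er e : lpa_rel (TMul (TEdge e) (TVertex (rng e))) (TEdge e)
| rel_rg e : lpa_rel (TMul (TVertex (rng e)) (TGhost e)) (TGhost e)
| rel_gs e : lpa_rel (TMul (TGhost e) (TVertex (src e))) (TGhost e)
| rel_ge e : lpa_rel (TMul (TGhost e) (TEdge e)) (TVertex (rng e))
| rel_gf e f : e <> f -> lpa_rel (TMul (TGhost e) (TEdge f)) TZero
(* l enumerates the edges emitted by the regular vertex v *)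
| rel_CK2 v (l : seq (edge E)) :
    uniq l -> l <> [::] -> (forall e, e \in l <-> src e = v) ->
    lpa_rel (TVertex v)
            (foldr TAdd TZero [seq TMul (TEdge e) (TGhost e) | e <- l]).

HB.instance Definition _ := gen_eqMixin lpa_term.
HB.instance Definition _ := gen_choiceMixin lpa_term.

Definition lpa_relb : rel lpa_term := fun x y => `[< lpa_rel x y >].

Lemma lpa_relb_equiv : equiv_class_of lpa_relb.
Proof.
split=> [x|x y|y x z].
- by apply/asboolP; exact: rel_refl.
- by apply/asboolP/asboolP => /rel_sym.
- by move=> /asboolP xy /asboolP yz; apply/asboolP; exact: rel_trans xy yz.
Qed.

Canonical lpa_equiv := EquivRelPack lpa_relb_equiv.

Definition lpa_sort : Type := {eq_quot lpa_equiv}.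

HB.instance Definition _ := Choice.on lpa_sort.
HB.instance Definition _ : EqQuotient _ lpa_equiv lpa_sort :=
  EqQuotient.on lpa_sort.

Definition lpa_pi (x : lpa_term) : lpa_sort := \pi x.

Lemma lpa_piP x y : lpa_pi x = lpa_pi y <-> lpa_rel x y.
Proof. by split=> [/eqmodP/asboolP //|xy]; apply/eqmodP/asboolP. Qed.

Lemma lpa_repr x : lpa_rel (repr (lpa_pi x)) x.
Proof. by apply/lpa_piP; rewrite /lpa_pi reprK. Qed.

Lemma lpaW (P : lpa_sort -> Prop) : (forall x, P (lpa_pi x)) -> forall a, P a.
Proof. by move=> Px a; rewrite -[a]reprK; exact: Px. Qed.

Definition lpa_zero : lpa_sort := lpa_pi TZero.
Definition lpa_opp (a : lpa_sort) := lpa_pi (TOpp (repr a)).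
Definition lpa_add (a b : lpa_sort) := lpa_pi (TAdd (repr a) (repr b)).
Definition lpa_scale r (a : lpa_sort) := lpa_pi (TScale r (repr a)).
Definition lpa_mul (a b : lpa_sort) := lpa_pi (TMul (repr a) (repr b)).

Lemma lpa_piN x : lpa_pi (TOpp x) = lpa_opp (lpa_pi x).
Proof. by apply/lpa_piP/rel_opp/rel_sym/lpa_repr. Qed.

Lemma lpa_piD x y : lpa_pi (TAdd x y) = lpa_add (lpa_pi x) (lpa_pi y).
Proof. by apply/lpa_piP/rel_add; apply/rel_sym/lpa_repr. Qed.

Lemma lpa_piZ r x : lpa_pi (TScale r x) = lpa_scale r (lpa_pi x).
Proof. by apply/lpa_piP/rel_scale/rel_sym/lpa_repr. Qed.

Lemma lpa_piM x y : lpa_pi (TMul x y) = lpa_mul (lpa_pi x) (lpa_pi y).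
Proof. by apply/lpa_piP/rel_mul; apply/rel_sym/lpa_repr. Qed.

Let piE := (lpa_piN, lpa_piD, lpa_piZ, lpa_piM).

Lemma lpa_addA : associative lpa_add.
Proof.
elim/lpaW=> x; elim/lpaW=> y; elim/lpaW=> z.
by rewrite -!piE; apply/lpa_piP/rel_addA.
Qed.

Lemma lpa_addC : commutative lpa_add.
Proof.
by elim/lpaW=> x; elim/lpaW=> y; rewrite -!piE; apply/lpa_piP/rel_addC.
Qed.

Lemma lpa_add0 : left_id lpa_zero lpa_add.
Proof. by elim/lpaW=> x; rewrite -!piE; apply/lpa_piP/rel_add0. Qed.

Lemma lpa_addN : left_inverse lpa_zero lpa_opp lpa_add.
Proof. by elim/lpaW=> x; rewrite -!piE; apply/lpa_piP/rel_addN. Qed.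

HB.instance Definition _ :=
  GRing.isZmodule.Build lpa_sort lpa_addA lpa_addC lpa_add0 lpa_addN.

Lemma lpa_scaleA r s (a : lpa_sort) :
  lpa_scale r (lpa_scale s a) = lpa_scale (r * s) a.
Proof. by elim/lpaW: a => x; rewrite -!piE; apply/lpa_piP/rel_scaleA. Qed.

Lemma lpa_scale1 : left_id 1 lpa_scale.
Proof. by elim/lpaW=> x; rewrite -!piE; apply/lpa_piP/rel_scale1. Qed.

Lemma lpa_scaleDr : right_distributive lpa_scale +%R.
Proof.
move=> r; elim/lpaW=> x; elim/lpaW=> y.
by rewrite /GRing.add /= -!piE; apply/lpa_piP/rel_scaleDr.
Qed.

Lemma lpa_scaleDl (a : lpa_sort) : {morph lpa_scale^~ a : r s / r + s}.
Proof.
elim/lpaW: a => x r s.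
by rewrite [RHS]/GRing.add /= -!piE; apply/lpa_piP/rel_scaleDl.
Qed.

HB.instance Definition _ := GRing.Zmodule_isLmodule.Build R lpa_sort
  lpa_scaleA lpa_scale1 lpa_scaleDr lpa_scaleDl.

Lemma lpa_mulA : associative lpa_mul.
Proof.
elim/lpaW=> x; elim/lpaW=> y; elim/lpaW=> z.
by rewrite -!piE; apply/lpa_piP/rel_mulA.
Qed.

Lemma lpa_mulDl : left_distributive lpa_mul +%R.
Proof.
elim/lpaW=> x; elim/lpaW=> y; elim/lpaW=> z.
by rewrite /GRing.add /= -!piE; apply/lpa_piP/rel_mulDl.
Qed.

Lemma lpa_mulDr : right_distributive lpa_mul +%R.
Proof.
elim/lpaW=> x; elim/lpaW=> y; elim/lpaW=> z.
by rewrite /GRing.add /= -!piE; apply/lpa_piP/rel_mulDr.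
Qed.

Lemma lpa_scaleAl r (a b : lpa_sort) : lpa_mul (r *: a) b = r *: lpa_mul a b.
Proof.
elim/lpaW: a => x; elim/lpaW: b => y.
by rewrite /GRing.scale /= -!piE; apply/lpa_piP/rel_scaleAl.
Qed.

Lemma lpa_scaleAr r (a b : lpa_sort) : lpa_mul a (r *: b) = r *: lpa_mul a b.
Proof.
elim/lpaW: a => x; elim/lpaW: b => y.
by rewrite /GRing.scale /= -!piE; apply/lpa_piP/rel_scaleAr.
Qed.

Definition leavitt_path_algebra : nu_algebra R :=
  NUAlgebra lpa_mulA lpa_mulDl lpa_mulDr lpa_scaleAl lpa_scaleAr.

Definition lpa_vertex v : leavitt_path_algebra := lpa_pi (TVertex v).
Definition lpa_edge e : leavitt_path_algebra := lpa_pi (TEdge e).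
Definition lpa_ghost e : leavitt_path_algebra := lpa_pi (TGhost e).

Lemma lpa_leavitt_family : leavitt_family lpa_vertex lpa_edge lpa_ghost.
Proof.
split=> [v w|e|e|e|e|e f|v [vfin [e0 e0v]]]; rewrite -?[LHS]lpa_piM.
- have [<-|/eqP vw] := eqVneq v w; first by apply/lpa_piP/rel_vv.
  by apply/lpa_piP/rel_vw.
- by apply/lpa_piP/rel_se.
- by apply/lpa_piP/rel_er.
- by apply/lpa_piP/rel_rg.
- by apply/lpa_piP/rel_gs.
- have [<-|/eqP vw] := eqVneq e f; first by apply/lpa_piP/rel_ge.
  by apply/lpa_piP/rel_gf.
have [l [lu lv]] : exists l : seq (edge E), uniq l /\
    forall e, e \in l <-> src e = v.
  exists (finmap.enum_fset (fset_set (out v))); split; first exact: finmap.fset_uniq.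
  by move=> e; rewrite in_fset_set// inE.
have -> : out v = [set` l] by apply/seteqP; split=> e /=; rewrite lv.
rewrite -fsbig_seq//; have lN : l <> [::].
  by move=> l0; have /lv := e0v; rewrite l0.
rewrite [LHS](proj2 (lpa_piP _ _) (rel_CK2 lu lN lv)) {lu lN lv}.
elim: l => [|e l IH]; first by rewrite big_nil.
by rewrite big_cons /= lpa_piD IH lpa_piM.
Qed.

Lemma lpa_universal (A : nu_algebra R) (V : vertex E -> A) (T T' : edge E -> A) :
  leavitt_family V T T' ->
  exists! h : leavitt_path_algebra -> A,
    [/\ nua_hom h, forall v, h (lpa_vertex v) = V v,
        forall e, h (lpa_edge e) = T e & forall e, h (lpa_ghost e) = T' e].
Proof.
move=> LF; pose ev := fix ev (x : lpa_term) : A := match x with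
  | TVertex v => V v | TEdge e => T e | TGhost e => T' e | TZero => 0
  | TOpp x => - ev x | TAdd x y => ev x + ev y | TScale r x => r *: ev x
  | TMul x y => ev x ** ev y end.
have evP x y : lpa_rel x y -> ev x = ev y.
  elim=> //=; clear x y.
  - by move=> x y z _ -> _ ->.
  - by move=> x y _ ->.
  - by move=> x y z t _ -> _ ->.
  - by move=> r x y _ ->.
  - by move=> x y z t _ -> _ ->.
  - by move=> x y z; rewrite addrA.
  - by move=> x y; rewrite addrC.
  - by move=> x; rewrite add0r.
  - by move=> x; rewrite addNr.
  - by move=> r s x; rewrite scalerA.
  - by move=> x; rewrite scale1r.
  - by move=> r x y; rewrite scalerDr.
  - by move=> r s x; rewrite scalerDl.
  - by move=> x y z; rewrite nua_mulA.
  - by move=> x y z; rewrite nua_mulDl.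
  - by move=> x y z; rewrite nua_mulDr.
  - by move=> r x y; rewrite nua_scaleAl.
  - by move=> r x y; rewrite nua_scaleAr.
  - by move=> v; rewrite (lf_vv LF) eqxx.
  - by move=> v w /eqP/negbTE vw; rewrite (lf_vv LF) vw.
  - by move=> e; rewrite (lf_se LF).
  - by move=> e; rewrite (lf_er LF).
  - by move=> e; rewrite (lf_rg LF).
  - by move=> e; rewrite (lf_gs LF).
  - by move=> e; rewrite (lf_CK1 LF) eqxx.
  - by move=> e f /eqP/negbTE ef; rewrite (lf_CK1 LF) ef.
  move=> v l lu lN lv.
  have ovE : out v = [set` l] by apply/seteqP; split=> e /=; rewrite lv.
  have vreg : regular v.
    split; first by rewrite ovE; exact: finite_seq.
    by case: l lN {lu ovE} lv => // e l _ lv; exists e; apply/lv; rewrite inE eqxx.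
  rewrite (lf_CK2 LF vreg) ovE -fsbig_seq// {lu lN lv ovE}.
  by elim: l => [|e l IH] /=; rewrite ?big_nil// big_cons IH.
have evr x : ev (repr (lpa_pi x)) = ev x by exact/evP/lpa_repr.
exists (fun a => ev (repr a)); split.
  split=> [|v|e|e]; try exact: evr.
  split=> [a b|r a|a b]; exact: evr.
move=> h [hh hV hT hT']; apply/funext; elim/lpaW=> x; rewrite evr.
have h0 : h 0 = 0 by rewrite -(scale0r 0) (nua_homZ hh) scale0r.
elim: x => /= [v|e|e||x IH|x IHx y IHy|r x IH|x IHx y IHy].
- by rewrite -hV.
- by rewrite -hT.
- by rewrite -hT'.
- by symmetry; exact: h0.
- rewrite IH; apply/eqP; rewrite eq_sym -subr_eq0 opprK lpa_piN.
  by rewrite -(nua_homD hh) [X in h X]addNr h0.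
- by rewrite IHx IHy lpa_piD -(nua_homD hh).
- by rewrite IH lpa_piZ -(nua_homZ hh).
- by rewrite IHx IHy lpa_piM -(nua_homM hh).
Qed.

End LeavittPathAlgebra.

Notation ring_ideal R := (ideal (@GRing.mul R)).
Notation lpa_ideal R E := (ideal (@nua_mul R (leavitt_path_algebra R E))).

Section SaturatedFunctions.
Variables (R : comPzRingType) (E : digraph).

Record saturated_function := SaturatedFunction {
  satf :> nehsat E -> ring_ideal R;
  satfP : forall (F : set (nehsat E)) (F0 : F !=set0),
    (satf (nehsat_join F0) : set R) = \bigcap_(K in F) (satf K : set R) }.

Definition corresponds (I : lpa_ideal R E) (f : saturated_function) :=
  forall K : nehsat E,
    (f K : set R) = [set r | forall v, hsat_set (sval K) v ->
                                 ideal_set I (r *: lpa_vertex R v)].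

(* Extension of f to all of T_E by the convention f(set0) = R: for H empty the
   condition is void, otherwise it says r \in f(H). *)
Definition satf_ext (f : saturated_function) (H : hsat E) : set R :=
  [set r | forall H0 : (H : set _) !=set0, ideal_set (f (exist _ H H0)) r].

Definition is_largest_hsat (f : saturated_function) (J : ring_ideal R)
    (H : hsat E) :=
  J `<=` satf_ext f H /\
  forall H' : hsat E, J `<=` satf_ext f H' -> H' `<=` H.

End SaturatedFunctions.

(* Main.v *)
Require Import Defs.
From mathcomp Require Import all_boot all_order all_algebra.
From mathcomp Require Import boolp classical_sets.
From mathcomp Require Import cardinality fsbigop.

(* The largest H is the set of vertices v with J v contained in I.  If v and w
   lie outside it, pick r, s in J with r v and s w outside I; primeness yields
   some a with r s (v a w) outside I.  As a is a combination of monomials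
   p q^*, so is v a w, with p and q paths from v and w to a common vertex u; if
   r s u were in I for every such u, then r s (v a w) would be in I as well. *)

Set Implicit Arguments.
Unset Strict Implicit.
Unset Printing Implicit Defensive.

Import GRing.Theory.
Local Open Scope ring_scope.
Local Open Scope classical_set_scope.
Local Open Scope nua_scope.

Lemma is_path_cat (E : digraph) (u v w : vertex E) p q :
  is_path u p v -> is_path v q w -> is_path u (p ++ q) w.
Proof.
elim: p u => [|e p IH] u /=; first by move=> ->.
by move=> [<- pv] qw; split=> //; exact: IH.
Qed.

(** * Ideals and primeness in an algebra without unit *)

Section NonUnitalAlgebra.
Variables (R : comPzRingType) (A : nu_algebra R).
Implicit Types (x y z a : A) (P : ideal (@nua_mul R A)).

Lemma nua_mul0x x : 0 ** x = 0.
Proof. by rewrite -{1}(scale0r 0) nua_scaleAl scale0r. Qed.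

Lemma nua_mulx0 x : x ** 0 = 0.
Proof. by rewrite -{1}(scale0r 0) nua_scaleAr scale0r. Qed.

Lemma nua_mulNx x y : (- x) ** y = - (x ** y).
Proof. by rewrite -scaleN1r nua_scaleAl scaleN1r. Qed.

Lemma nua_mulxN x y : x ** (- y) = - (x ** y).
Proof. by rewrite -scaleN1r nua_scaleAr scaleN1r. Qed.

Lemma idealD P x y : ideal_set P x -> ideal_set P y -> ideal_set P (x + y).
Proof.
by move=> Px Py; rewrite -[y]opprK -[- y]sub0r; do !apply: idealB => //; exact: ideal0.
Qed.

Lemma ideal_sum P (I : eqType) (s : seq I) (F : I -> A) :
  (forall i, i \in s -> ideal_set P (F i)) -> ideal_set P (\sum_(i <- s) F i).
Proof.
move=> PF; rewrite big_seq; apply: big_ind => //; first exact: ideal0.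
exact: idealD.
Qed.

Lemma prime_ideal_mul P x y : prime_ideal P -> ideal_set P (x ** y) ->
  (forall a, ideal_set P (x ** a ** y)) -> ideal_set P x \/ ideal_set P y.
Proof.
move=> [_ prP] Pxy Pxay.
(* K2 is the largest ideal with (x) K2 contained in P, and K1 the largest one
   with K1 K2 contained in P; this avoids ideals generated by an element. *)
pose S2 : set A := [set z | ideal_set P (x ** z) /\ forall a, ideal_set P (x ** a ** z)].
have S20 : S2 0.
  by split=> [|a]; rewrite nua_mulx0; exact: ideal0.
have S2B z1 z2 : S2 z1 -> S2 z2 -> S2 (z1 - z2).
  move=> [P1 Pa1] [P2 Pa2].
  by split=> [|a]; rewrite nua_mulDr nua_mulxN; exact: idealB.
(* The clause with [a] makes [S2] stable under left multiplication; the clause without [a], not a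
   special case in the absence of a unit, puts [x] into [S1]. *)
have S2l b z : S2 z -> S2 (b ** z).
  by move=> [_ Pa]; split=> [|a]; rewrite nua_mulA // -(nua_mulA x).
have S2r b z : S2 z -> S2 (z ** b).
  by move=> [Pz Pa]; split=> [|a]; rewrite nua_mulA; exact/Defs.idealMr.
pose K2 := Ideal S20 S2B S2l S2r.
pose S1 : set A := [set z | forall y', S2 y' -> ideal_set P (z ** y')].
have S10 : S1 0 by move=> y' _; rewrite nua_mul0x; exact: ideal0.
have S1B z1 z2 : S1 z1 -> S1 z2 -> S1 (z1 - z2).
  move=> P1 P2 y' Sy'; rewrite nua_mulDl nua_mulNx.
  by apply: idealB; [exact: P1|exact: P2].
have S1l b z : S1 z -> S1 (b ** z).
  by move=> Pz y' Sy'; rewrite -nua_mulA; apply: idealMl; exact: Pz.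
have S1r b z : S1 z -> S1 (z ** b).
  by move=> Pz y' Sy'; rewrite -nua_mulA; exact/Pz/S2l.
pose K1 := Ideal S10 S1B S1l S1r.
have [|K1P|K2P] := prP K1 K2.
- by move=> _ [s [sK ->]]; apply: ideal_sum => i /sK [K1i K2i]; exact: K1i.
- by left; apply: K1P => y' [].
- by right; exact: K2P.
Qed.

End NonUnitalAlgebra.

(** * Monomials [p q^*] and left multiplication by generators *)

Section LeavittFamily.
Variables (R : comPzRingType) (E : digraph) (A : nu_algebra R).
Variables (V : vertex E -> A) (T T' : edge E -> A).
Hypothesis LF : leavitt_family V T T'.
Implicit Types (u v w : vertex E) (e : edge E) (p q : seq (edge E)) (x y a b : A).

Definition path_elt p u : A := foldr (fun e x => T e ** x) (V u) p.

(** This is [q^*]: the ghost edges come in reverse order, so the source of [q] sits on the right. *)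
Definition ghost_elt q u : A := foldr (fun e x => x ** T' e) (V u) q.

Lemma vertex_path_elt v p u : is_path v p u -> V v ** path_elt p u = path_elt p u.
Proof.
case: p => [|e p] /=; first by move=> ->; rewrite (lf_vv LF) eqxx.
by move=> [<- _]; rewrite nua_mulA (lf_se LF).
Qed.

Lemma path_elt_vertex p u : path_elt p u ** V u = path_elt p u.
Proof.
elim: p => [|e p IH] /=; first by rewrite (lf_vv LF) eqxx.
by rewrite -nua_mulA IH.
Qed.

Lemma vertex_ghost_elt q u : V u ** ghost_elt q u = ghost_elt q u.
Proof.
elim: q => [|e q IH] /=; first by rewrite (lf_vv LF) eqxx.
by rewrite nua_mulA IH.
Qed.

Lemma ghost_elt_rcons q e :
  ghost_elt (rcons q e) (rng e) = T' e ** ghost_elt q (src e).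
Proof.
elim: q => [|f q IH] /=; first by rewrite (lf_rg LF) (lf_gs LF).
by rewrite IH nua_mulA.
Qed.

(** Only the source of [q] is fixed, because the elements to be described are the products
    [a ** V w]. *)
Inductive path_span w : A -> Prop :=
| path_span0 : path_span w 0
| path_spanD x y : path_span w x -> path_span w y -> path_span w (x + y)
| path_spanM r v u p q : is_path v p u -> is_path w q u ->
    path_span w (r *: (path_elt p u ** ghost_elt q u)).

Lemma path_spanZ w r x : path_span w x -> path_span w (r *: x).
Proof.
elim=> [|y z _ IHy _ IHz|s v u p q pvu qwu].
- by rewrite scaler0; exact: path_span0.
- by rewrite scalerDr; exact: path_spanD.
- by rewrite scalerA; exact: path_spanM pvu qwu.
Qed.

Lemma path_span_mul w a b :
    (forall v u p q, is_path v p u -> is_path w q u ->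
      path_span w (a ** (path_elt p u ** ghost_elt q u))) ->
  path_span w b -> path_span w (a ** b).
Proof.
move=> aM; elim=> [|y z _ IHy _ IHz|r v u p q pvu qwu].
- by rewrite nua_mulx0; exact: path_span0.
- by rewrite nua_mulDr; exact: path_spanD.
- by rewrite nua_scaleAr; apply: path_spanZ; exact: aM pvu qwu.
Qed.

Lemma path_spanM1 w v u p q : is_path v p u -> is_path w q u ->
  path_span w (path_elt p u ** ghost_elt q u).
Proof. by move=> pvu qwu; rewrite -[_ ** _]scale1r; exact: path_spanM pvu qwu. Qed.

Lemma path_span_vertexM w v b : path_span w b -> path_span w (V v ** b).
Proof.
apply: path_span_mul => v' u p q pvu qwu.
rewrite nua_mulA -(vertex_path_elt pvu) nua_mulA (lf_vv LF).
case: eqP => [->|_]; last by rewrite !nua_mul0x; exact: path_span0.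
by rewrite (vertex_path_elt pvu); exact: path_spanM1 pvu qwu.
Qed.

(** On a monomial, [e] either extends [p] at its start or gives 0. *)
Lemma path_span_edgeM w e b : path_span w b -> path_span w (T e ** b).
Proof.
apply: path_span_mul => v u p q pvu qwu.
rewrite nua_mulA -(lf_er LF) -(vertex_path_elt pvu) nua_mulA.
rewrite -[T e ** _ ** _]nua_mulA (lf_vv LF).
case: eqP => [rv|_]; last by rewrite nua_mulx0 !nua_mul0x; exact: path_span0.
rewrite (lf_er LF); apply: (@path_spanM1 _ (src e) _ (e :: p) _ _ qwu).
by rewrite /= rv.
Qed.

(** If [p] is nonempty, (CK1) cancels its first edge or gives 0. If [p] is empty, [e^* q^*] is the
    ghost of [q] followed by [e], or 0 when [e] does not start where [q] ends. *)
Lemma path_span_ghostM w e b : path_span w b -> path_span w (T' e ** b).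
Proof.
apply: path_span_mul => v u [|f p] q /=.
  move=> _ qwu; rewrite nua_mulA -(lf_gs LF) -nua_mulA -nua_mulA.
  rewrite vertex_ghost_elt -(vertex_ghost_elt q) [V _ ** (_ ** _)]nua_mulA.
  rewrite (lf_vv LF); case: eqP => [su|_]; last first.
    by rewrite nua_mul0x nua_mulx0; exact: path_span0.
  rewrite su vertex_ghost_elt -su -ghost_elt_rcons -vertex_ghost_elt.
  apply: (@path_spanM1 _ (rng e) _ [::]) => //.
  by rewrite -cats1; apply: is_path_cat qwu _; rewrite /= su.
move=> [_ pu] qwu; rewrite !nua_mulA (lf_CK1 LF).
case: eqP => [->|_]; last by rewrite !nua_mul0x; exact: path_span0.
by rewrite (vertex_path_elt pu); exact: path_spanM1 pu qwu.
Qed.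

(** * Scalar multiples of vertices in an ideal *)

Variable I : ideal (@nua_mul R A).

(** The definition of [ideal] does not include stability under scalars; here the idempotent [V v]
    carries the scalar into a product. *)
Lemma ideal_scale_vertex r s v :
  ideal_set I (s *: V v) -> ideal_set I ((r * s) *: V v).
Proof.
suff -> : (r * s) *: V v = (r *: V v) ** (s *: V v) by exact: idealMl.
by rewrite nua_scaleAr nua_scaleAl scalerA mulrC (lf_vv LF) eqxx.
Qed.

Lemma ideal_path v p w r :
  is_path v p w -> ideal_set I (r *: V v) -> ideal_set I (r *: V w).
Proof.
elim: p v => [|e p IH] v /=; first by move=> ->.
move=> [<- pw] Ir; apply: IH pw _.
have -> : r *: V (rng e) = T' e ** (r *: V (src e)) ** T e.
  by rewrite nua_scaleAr nua_scaleAl (lf_gs LF) (lf_CK1 LF) eqxx.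
exact/Defs.idealMr/idealMl.
Qed.

(** By (CK2), [r *: V v] is the sum of the [e (r r(e)) e^*] over the edges [e] leaving [v]. *)
Lemma ideal_regular v r : regular v ->
    (forall e, src e = v -> ideal_set I (r *: V (rng e))) ->
  ideal_set I (r *: V v).
Proof.
move=> vreg Ir; rewrite (lf_CK2 LF vreg) fsbig_finite; last by case: vreg.
rewrite scaler_sumr; apply: ideal_sum => e.
rewrite in_fset_set ?inE; last by case: vreg.
move=> /Ir Ire; rewrite -nua_scaleAr -(lf_rg LF) -nua_scaleAl.
exact/idealMl/Defs.idealMr.
Qed.

(** The factor [V v] kills every monomial of [x] whose [p] does not start at [v]; in the others
    [V u] can be inserted between [p] and [q^*], and it absorbs [r]. *)
Lemma ideal_span v w r x : path_span w x ->
    (forall u p q, is_path v p u -> is_path w q u -> ideal_set I (r *: V u)) ->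
  ideal_set I (r *: (V v ** x)).
Proof.
move=> wx Ir; elim: wx => [|y z _ IHy _ IHz|s v' u p q pvu qwu].
- by rewrite nua_mulx0 scaler0; exact: ideal0.
- by rewrite nua_mulDr scalerDr; exact: idealD.
rewrite nua_scaleAr scalerA mulrC -(vertex_path_elt pvu) !nua_mulA (lf_vv LF).
case: eqP => [vv'|_]; last by rewrite !nua_mul0x scaler0; exact: ideal0.
rewrite vv' (vertex_path_elt pvu) -path_elt_vertex -!nua_mulA.
rewrite -nua_scaleAr -nua_scaleAl.
apply/idealMl/Defs.idealMr/ideal_scale_vertex; apply: Ir qwu.
by rewrite vv'; exact: pvu.
Qed.

Definition annihilated (J : set R) : set (vertex E) :=
  [set v | forall r, J r -> ideal_set I (r *: V v)].

Lemma annihilated_hsat (J : set R) :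
  hereditary (annihilated J) /\ saturated (annihilated J).
Proof.
split=> [v p w pw Hv r Jr|v vreg Hv r Jr]; first exact/(ideal_path pw)/Hv.
by apply: ideal_regular => // e ev; apply: Hv => //; exists e.
Qed.

End LeavittFamily.

(** * The spanning result for [L] and downward directedness *)

Section LeavittPathAlgebra.
Variables (R : comPzRingType) (E : digraph).
Local Notation L := (leavitt_path_algebra R E).
Local Notation V := (@lpa_vertex R E).
Local Notation T := (@lpa_edge R E).
Local Notation T' := (@lpa_ghost R E).
Implicit Types (v w : vertex E) (a b : L).

Let LF := lpa_leavitt_family R E.

(** Elements of [L] are classes of terms, so induction on a term for [a] leaves only the generators
    to check. *)
Lemma lpa_path_spanMl w a b : path_span V T T' w b -> path_span V T T' w (a ** b).
Proof.
elim/lpaW: a => t; elim: t b => [v|e|e||t IH|t IHt s IHs|r t IH|t IHt s IHs] b wb.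
- exact: (path_span_vertexM LF).
- exact: (path_span_edgeM LF).
- exact: (path_span_ghostM LF).
- by rewrite [_ ** _]nua_mul0x; exact: path_span0.
- rewrite lpa_piN [_ ** _]nua_mulNx -scaleN1r; exact/path_spanZ/IH.
- rewrite lpa_piD [_ ** _]nua_mulDl; apply: path_spanD; [exact: IHt|exact: IHs].
- rewrite lpa_piZ [_ ** _]nua_scaleAl; exact/path_spanZ/IH.
- rewrite lpa_piM -[_ ** _]nua_mulA; exact/IHt/IHs.
Qed.

Lemma lpa_path_span_mul_vertex w a : path_span V T T' w (a ** V w).
Proof.
(* The idempotent [V w] is the monomial with [p] and [q] both empty. *)
apply: lpa_path_spanMl; rewrite -[V w](_ : V w ** V w = _).
  exact: (@path_spanM1 _ _ _ _ _ _ w w w [::] [::]).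
by rewrite (lf_vv LF) eqxx.
Qed.

Lemma prime_downward_directed (I : lpa_ideal R E) (J : ring_ideal R) :
  prime_ideal I -> downward_directed (~` annihilated V I J).
Proof.
move=> Iprime v w /existsNP[r /not_implyP[Jr NIr]] /existsNP[s /not_implyP[Js NIs]].
apply: contrapT => /forallNP Nu.
have Ia a : ideal_set I ((r *: V v) ** a ** (s *: V w)).
  rewrite nua_scaleAr !nua_scaleAl scalerA mulrC -nua_mulA.
  apply: (ideal_span LF (lpa_path_span_mul_vertex w a)).
  (* Since [r * s] lies in [J], a vertex [u] with [(r * s) *: V u] outside [I] would be a common
     descendant outside the annihilated set. *)
  move=> u p q pvu qwu; apply: contrapT => NIu; apply: (Nu u); split.
  - by move=> /(_ (r * s) (Defs.idealMr _ Jr)).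
  - by exists p.
  - by exists q.
(* This is the case [a = V v] of [Ia]. *)
have Irs : ideal_set I ((r *: V v) ** (s *: V w)).
  suff -> : r *: V v = (r *: V v) ** V v by [].
  by rewrite nua_scaleAl (lf_vv LF) eqxx.
by case: (prime_ideal_mul Iprime Irs Ia).
Qed.

End LeavittPathAlgebra.

Theorem lemma6p32 (R : comPzRingType) (E : digraph)
  (Erf : row_finite E) (ECu : C_u E = set0)
  (I : lpa_ideal R E) (f : saturated_function R E) (If : corresponds I f)
  (Iprime : prime_ideal I) (J : ring_ideal R) :
  exists H : hsat E,
    is_largest_hsat f J H /\ downward_directed (~` (hsat_set H))%classic.
Proof.
exists (HSat (annihilated_hsat (lpa_leavitt_family R E) I J)).
split; last exact: prime_downward_directed.
split=> [r Jr H0|H' JH' v H'v r Jr]; first by rewrite If => v; exact.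
(* The convention for the empty set makes [satf_ext] conditional on nonemptiness; the vertex [v]
   under consideration supplies it. *)
have H'0 : (H' : set _) !=set0 by exists v.
by have := JH' r Jr H'0; rewrite If; exact.
Qed.
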